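(* Let $G(V,E)$ be a connected trivalent graph and let $\Gamma_1,\Gamma_2$ be any two oriented ribbon graphs of it. Then the vertex polynomials agree up to sign, $$V(\Gamma_1,n)=\pm V(\Gamma_2,n),$$ where the sign is positive if $\Gamma_1$ and $\Gamma_2$ are even with respect to each other and negative if they are odd with respect to each other.
   Context: Graphs are finite multigraphs (loops and multiple edges allowed); trivalent means $V\neq\emptyset$ and every vertex has degree 3 (a loop counts twice). A ribbon graph $\Gamma$ of $G$ is a compact surface with boundary in which $G$ is embedded and which deformation retracts onto $G$; combinatorially it is given by a cyclic ordering of the half-edges at each vertex and a sign for each edge (a disc for each vertex, a band for each edge, a half-twist in the bands of negative edges). It is oriented if the surface is orientable with a chosen orientation. Capping the boundary circles by discs gives a closed surface $\overline\Gamma$. Two ribbon graphs of $G$ are equivalent if there is a homeomorphism of the closed surfaces (not required to preserve orientations) inducing an isomorphism of the underlying graphs. $\Gamma_1$ is even (odd) with respect to $\Gamma_2$ if the number of half-twists that need to be inserted into the bands of $\Gamma_1$ to make it equivalent to $\Gamma_2$ is even (odd). For $\nu\in\{0,1\}^V$, $\Gamma_\nu$ is the ribbon graph obtained from $\Gamma$ by inserting, for each vertex $v$ with $\nu_v=1$, a half-twist in each of the three half-bands at $v$ (two half-twists in one band cancel); $k_\nu$ is its number of boundary circles and $|\nu|=\sum_v\nu_v$. The vertex polynomial is $V(\Gamma,n)=\sum_{\nu\in\{0,1\}^V}(-1)^{|\nu|}n^{k_\nu}$. *)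

(* Defs.v *)
From HB Require Import structures.
From mathcomp Require Import all_boot all_order all_algebra all_fingroup.

Set Implicit Arguments.
Unset Strict Implicit.
Unset Printing Implicit Defensive.

Import GRing.Theory.
Local Open Scope ring_scope.

(* The half-edges of an edge e are (e, false) and (e, true); endpt sends a     *)
(* half-edge to the vertex it is attached to, so loops and multiple edges are  *)
(* allowed.                                                                    *)
Record mgraph := MGraph {
  vertex : finType;
  edge : finType;
  endpt : edge * bool -> vertex }.

Notation hedge G := (edge G * bool)%type.

Definition opp (G : mgraph) (h : hedge G) : hedge G := (h.1, ~~ h.2).

Definition star (G : mgraph) (v : vertex G) : {set hedge G} :=
  [set h | endpt h == v].

Definition trivalent (G : mgraph) : Prop :=
  (0 < #|vertex G|)%N /\ forall v : vertex G, #|star v| = 3%N.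

Definition adjacent (G : mgraph) : rel (vertex G) :=
  fun v w => [exists h : hedge G, (endpt h == v) && (endpt (opp h) == w)].

Definition connected_graph (G : mgraph) : Prop :=
  forall v w : vertex G, connect (@adjacent G) v w.

(* The cycles of rot are the cyclic orderings of the half-edges at the         *)
(* vertices; sgn e = true means that the band of e carries a half-twist.       *)
Record ribbon (G : mgraph) := Ribbon {
  rot : {perm hedge G};
  rotP : forall h : hedge G, porbit rot h = star (endpt h);
  sgn : {ffun edge G -> bool} }.

(* A choice of orientations of the vertex discs, where o v = true means that   *)
(* the orientation given by rot at v is reversed, extends over the band of e   *)
(* iff the twist of the band is o v (+) o w, with v and w the ends of e.       *)
Definition is_orientation (G : mgraph) (A : ribbon G)
    (o : {ffun vertex G -> bool}) : Prop :=
  forall e : edge G, sgn A e = o (endpt (e, false)) (+) o (endpt (e, true)).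

Record oriented_ribbon (G : mgraph) := OrientedRibbon {
  ribbon_of :> ribbon G;
  orient : {ffun vertex G -> bool};
  orientP : is_orientation ribbon_of orient }.

(* The boundary of the surface, outside the ends of the bands, consists of     *)
(* arcs of the vertex discs and of sides of the bands.  The flag (h, true) is  *)
(* the corner of the half-band h that faces rot h, and (h, false) is the one   *)
(* that faces rot^-1 h: corner_arc follows the boundary of a vertex disc, and  *)
(* band_side the boundary of a band, which for an untwisted band joins         *)
(* opposite sides of h and opp h.                                              *)
Definition corner_arc (G : mgraph) (A : ribbon G)
    (x : hedge G * bool) : hedge G * bool :=
  if x.2 then (rot A x.1, false) else (((rot A)^-1)%g x.1, true).

Definition band_side (G : mgraph) (A : ribbon G)
    (x : hedge G * bool) : hedge G * bool :=
  (opp x.1, ~~ x.2 (+) sgn A x.1.1).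

(* An isolated vertex is a disc, whose boundary circle meets no flag.          *)
Definition boundary_circles (G : mgraph) (A : ribbon G) : nat :=
  (n_comp [rel x y | (corner_arc A x == y) || (band_side A x == y)]
          [pred _ : hedge G * bool | true]
   + #|[set v : vertex G | star v == set0]|)%N.

Definition insert_twists (G : mgraph) (A : ribbon G)
    (t : {ffun edge G -> nat}) : ribbon G :=
  Ribbon (@rotP G A) [ffun e => sgn A e (+) odd (t e)].

Definition vertex_twist (G : mgraph) (A : ribbon G)
    (nu : {ffun vertex G -> bool}) : ribbon G :=
  insert_twists A
    [ffun e => (nu (endpt (e, false)) + nu (endpt (e, true)))%N].

Definition vertex_poly (G : mgraph) (A : ribbon G) : {poly int} :=
  \sum_(nu : {ffun vertex G -> bool})
    (-1) ^+ (\sum_(v : vertex G) nu v)%N *: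
      'X^(boundary_circles (vertex_twist A nu)).

(* A homeomorphism carrying one embedded graph to the other, seen on the       *)
(* discs and bands: (phi, psi) is the induced isomorphism of graphs, and f     *)
(* tells at which vertex discs the homeomorphism reverses the orientations     *)
(* given by the two rotations.  Reversing at exactly one end of a band adds a  *)
(* half-twist to it.                                                           *)
Definition equivalent (G : mgraph) (A B : ribbon G) : Prop :=
  exists (phi : {perm vertex G}) (psi : {perm hedge G})
         (f : {ffun vertex G -> bool}),
    [/\ forall h, endpt (psi h) = phi (endpt h),
        forall h, psi (opp h) = opp (psi h),
        forall h, rot B (psi h) =
          psi (if f (endpt h) then ((rot A)^-1)%g h else rot A h)
      & forall h, sgn B (psi h).1 =
          sgn A h.1 (+) f (endpt h) (+) f (endpt (opp h))].

Definition even_wrt (G : mgraph) (A B : ribbon G) : Prop :=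
  exists2 t : {ffun edge G -> nat},
    ~~ odd (\sum_(e : edge G) t e)%N & equivalent (insert_twists A t) B.

Definition odd_wrt (G : mgraph) (A B : ribbon G) : Prop :=
  exists2 t : {ffun edge G -> nat},
    odd (\sum_(e : edge G) t e)%N & equivalent (insert_twists A t) B.

(* Main.v *)
(* A vertex labelling g of G twists the band of e by g(v) + g(w), v and w      *)
(* being its ends.  As two cyclic orders on three elements are equal or        *)
(* opposite, twists make any ribbon graph of G equivalent to any other.  When  *)
(* both are orientable these twists come from some g, and inserting them       *)
(* turns the summand of nu into that of nu + g, so the vertex polynomial gets  *)
(* multiplied by (-1)^|g|; this is the parity of the number of twists, because *)
(* every vertex has odd degree.                                                *)
Require Import Defs.
From mathcomp Require Import all_boot all_order all_algebra all_fingroup.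

Import GRing.Theory.
Local Open Scope ring_scope.

(** On an oriented ribbon graph the edge signs are the coboundary of [orient]. So if
    [insert_twists A t] is equivalent to [B], then [t] mod 2 is the coboundary of a vertex labelling
    [g], and translating the summation index by [g] matches the summands of both polynomials
    ([equivalent_vertex_poly]), as equivalence preserves boundary circles. This costs the sign
    (-1)^|g|, which [signr_sum_endpts] turns into the parity of [t]. Some [t] always exists by
    [trivalent_equivalent_twists]. *)

Lemma n_comp_bij (T T' : finType) (e : rel T) (e' : rel T') (F : T -> T') :
  bijective F -> symmetric e -> symmetric e' ->
  (forall x y, e' (F x) (F y) = e x y) ->
  n_comp e [pred _ : T | true] = n_comp e' [pred _ : T' | true].
Proof.
move=> [F' FK F'K] sym_e sym_e' Fe; symmetry.
apply: (@adjunction_n_comp _ _ F).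
- exact: sym_connect_sym.
- exact: sym_connect_sym.
- by move=> x y _.
apply: strict_adjunction => //.
- exact: sym_connect_sym.
- exact: can_inj FK.
- by apply/subsetP=> x _; rewrite -(F'K x) codom_f.
Qed.

Lemma porbit3 (T : finType) (s : {perm T}) (x : T) : #|porbit s x| = 3 ->
  [/\ uniq [:: x; s x; s (s x)], porbit s x =i [:: x; s x; s (s x)]
    & s (s (s x)) = x].
Proof.
move=> s3; have /= := uniq_traject_porbit s x.
have := porbit_traject s x; have := iter_porbit s x.
by rewrite s3 /= => ? eq_s ?; split=> // y; rewrite eq_s.
Qed.

(** A 3-cycle is determined by the image of one point [x], for which only [s x] and [s (s x)] are
    available. *)
Lemma three_cycle_cases (T : finType) (s t : {perm T}) (x : T) :
  #|porbit s x| = 3 -> porbit t x = porbit s x ->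
  {in porbit s x, t =1 s} \/ {in porbit s x, t =1 (s^-1)%g}.
Proof.
move=> s3 ts; have t3 : #|porbit t x| = 3 by rewrite ts.
have [us Ps sx] := porbit3 _ _ _ s3; have [ut Pt tx] := porbit3 _ _ _ t3.
have := mem_porbit t 2 x; have := mem_porbit t 1 x.
rewrite ts expg1 expgS expg1 permM !Ps; move: us ut tx; rewrite /= !inE.
set a := s x; set b := s a; set c := t x; set d := t c.
rewrite !negb_or => /and3P[/andP[xa xb] ab _] /and3P[/andP[xc xd] cd _] tx.
have sbx : s b = x by [].
rewrite (eq_sym c x) (negPf xc) (eq_sym d x) (negPf xd) /=.
case/orP=> /eqP ec /orP[]/eqP ed.
- by rewrite ec ed eqxx in cd.
- left=> y; rewrite Ps !inE => /or3P[]/eqP->; first by [].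
  + by rewrite -/a -{1}ec -/d ed.
  + by rewrite -/a -/b -{1}ed sbx.
- right=> y; rewrite Ps !inE => /or3P[]/eqP->; apply: (@perm_inj _ s);
    rewrite permKV.
  + by rewrite -/c ec.
  + by rewrite -/a -ed tx.
  + by rewrite -/a -/b -ec -/d ed.
- by rewrite ec ed eqxx in cd.
Qed.

Section Ribbon.
(* mathcomp shadows opp and rot. *)
Import Defs.
Context {G : mgraph}.
Implicit Types (A B : ribbon G) (h : hedge G) (g : vertex G -> bool).

Lemma oppK : involutive (@opp G).
Proof. by case=> e b; rewrite /opp /= negbK. Qed.

Lemma endpt_rot A h : endpt (rot A h) = endpt h.
Proof.
apply/eqP; have : rot A h \in star (endpt h).
  by rewrite -(rotP A); apply: (mem_porbit (rot A) 1).
by rewrite inE.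
Qed.

Lemma endpt_rotV A h : endpt ((rot A)^-1%g h) = endpt h.
Proof. by rewrite -[in RHS](permKV (rot A) h) endpt_rot. Qed.

Lemma corner_arcK A : involutive (corner_arc A).
Proof. by case=> h [] /=; rewrite /corner_arc /= ?permK ?permKV. Qed.

Lemma band_sideK A : involutive (band_side A).
Proof.
case=> h b; rewrite /band_side /= oppK; congr pair.
by case: b; case: (sgn _ _).
Qed.

Lemma flag_rel_sym A :
  symmetric [rel x y | (corner_arc A x == y) || (band_side A x == y)].
Proof.
move=> x y /=; congr orb.
- by rewrite (can2_eq (corner_arcK A) (corner_arcK A)) eq_sym.
- by rewrite (can2_eq (band_sideK A) (band_sideK A)) eq_sym.
Qed.

Lemma equivalent_boundary_circles A B :
  equivalent A B -> boundary_circles A = boundary_circles B.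
Proof.
case=> phi [psi [f [endpt_psi opp_psi rot_psi sgn_psi]]].
(* Reversing a vertex disc exchanges the two corners of each of its half-bands. *)
pose F (x : hedge G * bool) := (psi x.1, x.2 (+) f (endpt x.1)).
have F_inj : injective F.
  by case=> h b [k c] [] /perm_inj <- /addIb <-.
have Fcorner x : corner_arc B (F x) = F (corner_arc A x).
  have rotV_psi h : (rot B)^-1%g (psi h) =
      psi (if f (endpt h) then rot A h else (rot A)^-1%g h).
    apply: (@perm_inj _ (rot B)); rewrite permKV rot_psi.
    by case fh: (f (endpt h)); rewrite ?endpt_rot ?endpt_rotV fh ?permK ?permKV.
  case: x => h [] /=; rewrite /corner_arc /F /= ?endpt_rot ?endpt_rotV;
    by case fh: (f (endpt h)) => /=; rewrite ?rot_psi ?rotV_psi fh.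
have Fband x : band_side B (F x) = F (band_side A x).
  case: x => h b; rewrite /band_side /F /= opp_psi sgn_psi; congr pair.
  by case: b (sgn A h.1) (f (endpt h)) (f (endpt (opp h))) => [] [] [] [].
apply: (f_equal2 addn) (erefl _).
apply: (n_comp_bij _ _ _ _ F (injF_bij F_inj) (flag_rel_sym A) (flag_rel_sym B)).
by move=> x y; rewrite /= Fcorner Fband !(inj_eq F_inj).
Qed.

Lemma addb_endpts g h :
  g (endpt (h.1, false)) (+) g (endpt (h.1, true)) =
  g (endpt h) (+) g (endpt (opp h)).
Proof. by case: h => e [] //=; rewrite addbC. Qed.

Lemma sgn_vertex_twist A (nu : {ffun vertex G -> bool}) h :
  sgn (vertex_twist A nu) h.1 =
  sgn A h.1 (+) (nu (endpt h) (+) nu (endpt (opp h))).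
Proof. by rewrite !ffunE oddD !oddb addb_endpts. Qed.

Lemma sgn_oriented (A : oriented_ribbon G) h :
  sgn A h.1 = orient A (endpt h) (+) orient A (endpt (opp h)).
Proof. by rewrite orientP addb_endpts. Qed.

(** Double counting: the product of (-1)^g over the half-edges is grouped by edges, then by
    vertices, where each factor occurs three times and 3 is odd. *)
Lemma signr_sum_endpts (Gtriv : trivalent G) (t : edge G -> nat) g :
  (forall e, odd (t e) = g (endpt (e, false)) (+) g (endpt (e, true))) ->
  (-1) ^+ (\sum_e t e)%N = (-1) ^+ (\sum_v g v)%N :> int.
Proof.
move=> tg; transitivity (\prod_(h : hedge G) (-1) ^+ g (endpt h) : int).
  rewrite [RHS](eq_bigr (fun h => (-1) ^+ g (endpt (h.1, h.2)))); last by case.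
  rewrite -prodrXr -(pair_bigA _ (fun e b => (-1) ^+ g (endpt (e, b)))) /=.
  apply: eq_bigr => e _; rewrite -signr_odd tg signr_addb.
  by rewrite big_bool mulrC.
rewrite (partition_big (@endpt G) predT) //= -prodrXr.
apply: eq_bigr => v _.
rewrite (eq_bigr (fun _ => (-1) ^+ g v)); last by move=> h /eqP->.
rewrite prodr_const -exprM -signr_odd oddM oddb.
have -> : #|[pred h | endpt h == v]| = 3%N.
  by rewrite -(Gtriv.2 v); apply: eq_card => h; rewrite !inE.
by rewrite andbT.
Qed.

Lemma equivalent_vertex_poly (Gtriv : trivalent G) (A B : oriented_ribbon G)
    (t : {ffun edge G -> nat}) :
  equivalent (insert_twists A t) B ->
  vertex_poly A = (-1) ^+ (\sum_e t e)%N *: vertex_poly B.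
Proof.
case=> phi [psi [f [endpt_psi opp_psi rot_psi sgn_psi]]].
(* [g] compares the orientation of [A] with that of [B] pulled back along the homeomorphism. *)
pose g v := orient A v (+) f v (+) orient B (phi v).
have tg h : odd (t h.1) = g (endpt h) (+) g (endpt (opp h)).
  have := sgn_psi h; rewrite ffunE !sgn_oriented -opp_psi !endpt_psi /g.
  do 2!case: (orient B _); do 2!case: (orient A _); do 2!case: (f _);
    by case: (odd _).
have sg := signr_sum_endpts Gtriv t g (fun e => tg (e, false)).
(* The same phi, psi and f make [A] twisted by [T nu] equivalent to [B] twisted by [nu]. *)
pose T (nu : {ffun vertex G -> bool}) : {ffun vertex G -> bool} :=
  [ffun v => nu (phi v) (+) g v].
have T_inj : injective T.
  move=> nu nu' /ffunP eqT; apply/ffunP=> v.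
  by have := eqT (phi^-1 v)%g; rewrite !ffunE permKV => /addIb.
rewrite /vertex_poly [LHS](reindex_inj T_inj) [RHS]scaler_sumr.
apply: eq_bigr => nu _.
rewrite scalerA sg.
apply: (f_equal2 (fun (a : int) k => a *: 'X^k)).
  rewrite -!prodrXr [X in _ = _ * X](reindex_inj (@perm_inj _ phi)) -big_split.
  by apply: eq_bigr => v _; rewrite ffunE signr_addb mulrC.
apply: equivalent_boundary_circles; exists phi, psi, f; split=> // h.
rewrite !sgn_vertex_twist sgn_psi -opp_psi !endpt_psi !ffunE tg.
do 2!case: (nu _); do 2!case: (g _); do 2!case: (f _); by case: (sgn _ _).
Qed.

Lemma trivalent_equivalent_twists (Gtriv : trivalent G) A B :
  exists t : {ffun edge G -> nat}, equivalent (insert_twists A t) B.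
Proof.
(* Where the rotations differ they are inverse to each other, so the disc is flipped; the coboundary
   of [f] in the witness cancels the half-twists that this adds. *)
pose f v := [exists h in star v, rot B h != rot A h].
exists [ffun e => sgn A e (+) sgn B e
  (+) (f (endpt (e, false)) (+) f (endpt (e, true))) : nat].
exists 1%g, 1%g, [ffun v => f v]; split=> h; rewrite !perm1 //.
- have hh : h \in star (endpt h) by rewrite inE.
  rewrite ffunE /f; case: existsP => [[k /andP[kh neq_k]]|eqr]; last first.
    apply/eqP/negPn/negP=> neq_h; apply: eqr; exists h.
    by rewrite hh.
  have [||eqAB|->] // := @three_cycle_cases _ (rot A) (rot B) h.
  + by rewrite rotP Gtriv.2.
  + by rewrite !rotP.
  + by case/eqP: neq_k; apply: eqAB; rewrite rotP.
  + by rewrite rotP.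
- rewrite !ffunE oddb addb_endpts.
  by case: (sgn A h.1) (sgn B h.1) (f (endpt h)) (f (endpt (opp h))) => [] [] [] [].
Qed.

End Ribbon.

Theorem lemma7p2 (G : mgraph) (Gconn : connected_graph G)
    (Gtriv : trivalent G) (A1 A2 : oriented_ribbon G) :
  [/\ vertex_poly A1 = vertex_poly A2 \/ vertex_poly A1 = - vertex_poly A2,
      even_wrt A1 A2 -> vertex_poly A1 = vertex_poly A2
    & odd_wrt A1 A2 -> vertex_poly A1 = - vertex_poly A2].
Proof.
(* Any [t] that realises the equivalence fixes the sign by its parity, which yields all three
   claims. *)
have signE (t : {ffun edge G -> nat}) : equivalent (insert_twists A1 t) A2 ->
    vertex_poly A1 = if odd (\sum_e t e) then - vertex_poly A2
                     else vertex_poly A2.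
  move/(equivalent_vertex_poly Gtriv) => ->; rewrite -signr_odd.
  by case: odd; rewrite ?scaleN1r ?scale1r.
split.
- have [t /signE ->] := trivalent_equivalent_twists Gtriv A1 A2.
  by case: odd; [right | left].
- by case=> t /negPf ev /signE ->; rewrite ev.
- by case=> t od /signE ->; rewrite od.
Qed.
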